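(* In the synchronous sleeping model on $n$ processors there is a Crash Agreement algorithm that tolerates any number $f<n$ of crash faults and has awake complexity $O(\log f)$ and round complexity $O(f)$.
   Context: Model. There is a set of $n$ processors, each with a unique ID in $[1,n]$, forming a synchronous clique network (every two processors have a communication link). Time is partitioned into rounds; in each round every processor sends some (or no) messages, then every message sent at the beginning of the round is received by its destination, then every processor performs local computation. Sleeping model. In any round $t$ a processor may decide to sleep in rounds $t+1,\dots,t+r$, for any number $r$ of its choice, and wake up in round $t+r+1$. While sleeping it cannot send or receive messages, and every message sent to it in those rounds is permanently lost. The round complexity is the number of rounds the algorithm takes. The awake complexity is the maximum number of rounds any single processor spends awake during any execution of the algorithm. Crash faults. A worst-case adversary may crash processors at any time, as long as no more than $f$ processors are faulty. When it crashes a processor $p$ in round $t$, it chooses which of the messages $p$ sent in round $t$ arrive at their destination; afterwards $p$ stops participating completely. The crashed processors are the faulty ones; all others are non-faulty. Crash Agreement. Every processor $p$ has an input value in a set $V$ of possible values and must return an output value in $V$ such that: (Safety) if a non-faulty processor outputs $v$, then every non-faulty processor must output $v$; (Validity) if all the non-faulty processors have the same input $v$, then every non-faulty processor must output $v$; (Termination) every non-faulty processor must output a value after a finite number of rounds.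
   Formalization: Validity for a common input of the non-faulty processors is required only when 2f < n; for n ≤ 2f, where no algorithm can achieve it once V has two values, validity is required only when all processors, faulty ones included, have the same input. *)

(* Defs.v *)
From mathcomp Require Import all_boot.

Set Implicit Arguments.
Unset Strict Implicit.
Unset Printing Implicit Defensive.

(* Local decision taken at the end of a round in which a processor is awake:
   [Sleep r s] sleeps through the next [r] rounds and wakes up with state [s]
   ([r = 0] means staying awake); [Return v] outputs [v] and halts. *)
Inductive action (V S : Type) : Type :=
  | Sleep of nat & S
  | Return of V.
Arguments Sleep {V S}.
Arguments Return {V S}.

(* A deterministic algorithm for the processors ['I_n], which know their ID
   (and [n], as well as any parameter the algorithm is chosen to depend on).
   [send p s q] is the message, if any, that [p] sends to [q] when awake in
   state [s]; [compute p s inbox] is the local computation ending the round. *)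
Record algorithm (n : nat) (V : Type) : Type := Algorithm {
  state : Type;
  message : Type;
  init : 'I_n -> V -> state;
  send : 'I_n -> state -> 'I_n -> option message;
  compute : 'I_n -> state -> ('I_n -> option message) -> action V state
}.

(* [crash_round p = Some t] : [p] is crashed in round [t], and [arrives p q]
   tells whether the message [p] sends to [q] in that round is let through.
   Algorithms being deterministic, an adaptive adversary is no more powerful
   than the choice of one such schedule. Rounds are numbered from 0. *)
Record adversary (n : nat) : Type := Adversary {
  crash_round : 'I_n -> option nat;
  arrives : 'I_n -> 'I_n -> bool
}.

Definition faulty n (adv : adversary n) (p : 'I_n) : bool :=
  crash_round adv p != None.

Definition nonfaulty n (adv : adversary n) (p : 'I_n) : bool :=
  ~~ faulty adv p.

Definition crashes_at_most n (adv : adversary n) (f : nat) : Prop :=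
  #|[set p | faulty adv p]| <= f.

(* [Running w s] : [p] sleeps for [w] more rounds, and is awake if [w = 0]. *)
Inductive status (V S : Type) : Type :=
  | Running of nat & S
  | Returned of V
  | Crashed.
Arguments Running {V S}.
Arguments Returned {V S}.
Arguments Crashed {V S}.

Section Execution.

Variables (n : nat) (V : Type) (A : algorithm n V).
Variables (input : 'I_n -> V) (adv : adversary n).

Definition configuration : Type := 'I_n -> status V (state A).

Definition awake (c : configuration) (p : 'I_n) : bool :=
  if c p is Running 0 _ then true else false.

Definition sent (c : configuration) (p q : 'I_n) : option (message A) :=
  if c p is Running 0 s then if p == q then None else send p s q else None.

Definition inbox (t : nat) (c : configuration) (q p : 'I_n) :
    option (message A) :=
  if (crash_round adv p == Some t) && ~~ arrives adv p q then None
  else sent c p q.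

Definition round (t : nat) (c : configuration) : configuration := fun p =>
  if crash_round adv p == Some t then Crashed else
  match c p with
  | Running 0 s =>
      match compute p s (inbox t c p) with
      | Sleep r s' => Running r s'
      | Return v => Returned v
      end
  | Running w.+1 s => Running w s
  | Returned v => Returned v
  | Crashed => Crashed
  end.

(* [exec t] is the configuration at the beginning of round [t], i.e. after the
   first [t] rounds; all processors are awake in the first round. *)
Fixpoint exec (t : nat) : configuration :=
  if t is t'.+1 then round t' (exec t')
  else fun p => Running 0 (init A p (input p)).

Definition outputs (p : 'I_n) (v : V) : Prop :=
  exists t, exec t p = Returned v.

Definition awake_rounds (p : 'I_n) (T : nat) : nat :=
  \sum_(t < T) awake (exec t) p.

Definition stopped_after (T : nat) : Prop :=
  forall p w s, exec T p <> Running w s.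

Definition safety : Prop :=
  forall p v, nonfaulty adv p -> outputs p v ->
  forall q, nonfaulty adv q -> outputs q v.

Definition validity : Prop :=
  forall v, (forall p, nonfaulty adv p -> input p = v) ->
  forall p, nonfaulty adv p -> outputs p v.

Definition common_input_validity : Prop :=
  forall v, (forall p, input p = v) ->
  forall p, nonfaulty adv p -> outputs p v.

Definition termination : Prop :=
  forall p, nonfaulty adv p -> exists v, outputs p v.

End Execution.

(* [validity] disregards the inputs of the processors that crash, even of those
   that crash only in the round in which they would have returned, with all
   their messages delivered. When [n <= f.*2] and [V] has two elements, this is
   incompatible with [safety] and [termination]: if [f] processors have one
   input and the other [n - f <= f] have another one, crashing either group in
   this way leaves the outputs of the other group as in the crash-free
   execution. In that range, validity is thus only required in the usual sense
   for crash faults, that is, for an input common to all the processors. *)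
Definition solves_crash_agreement n V (A : algorithm n V) (f : nat) : Prop :=
  forall (input : 'I_n -> V) (adv : adversary n), crashes_at_most adv f ->
  [/\ safety A input adv,
      common_input_validity A input adv,
      f.*2 < n -> validity A input adv &
      termination A input adv].

(* Both complexities also account for the processors that end up crashing. *)
Definition awake_complexity_le n V (A : algorithm n V) (f k : nat) : Prop :=
  forall (input : 'I_n -> V) (adv : adversary n), crashes_at_most adv f ->
  forall p T, awake_rounds A input adv p T <= k.

Definition round_complexity_le n V (A : algorithm n V) (f k : nat) : Prop :=
  forall (input : 'I_n -> V) (adv : adversary n), crashes_at_most adv f ->
  stopped_after A input adv k.

(* Main.v *)
Require Import Defs.
From mathcomp Require Import all_boot boolp zify.

Set Implicit Arguments.
Unset Strict Implicit.
Unset Printing Implicit Defensive.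

(** A class of [m] processors reaches agreement by letting the first half
    agree recursively, then send its value to the second half, which adopts it,
    and then letting the second half agree recursively. If some processor of
    the first half survives the sending round, the whole second half starts
    with the value of the first half, and keeps it; otherwise the first half
    has died out, and the agreement of the second half is all that is needed.
    This takes [m - 1] rounds, in only [log m] of which a given processor is
    awake. It is run on the first [2 ^ k > f] processors, at least one of which
    is non-faulty, and their common value is broadcast to all in a last round.
    In a preliminary round, all inputs are exchanged and a value received more
    than [f] times, hence from some non-faulty processor, replaces the input;
    when [f.*2 < n] this makes a common input of the non-faulty processors
    common to all the processors still alive. *)

(* Unfolding the recursion in time, the halves of the block
   [c * 2 ^ j.+1, c.+1 * 2 ^ j.+1) of IDs meet in the round numbered by the
   midpoint of the block, and the recursive calls on its halves occupy the
   rounds strictly inside them. *)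
Definition meetings (k p : nat) : seq nat :=
  [seq p %/ 2 ^ j.+1 * 2 ^ j.+1 + 2 ^ j | j <- iota 0 k].

(** Round 0 exchanges the inputs and round [2 ^ k] is the final broadcast. *)
Definition active (k p t : nat) : bool := t \in [:: 0, 2 ^ k & meetings k p].

(** * Arithmetic of the meeting rounds *)

(** A meeting of level [i] is a multiple of [2 ^ i], so [i < j]; its block of size [2 ^ i.+1] then
    lies inside one block of size [2 ^ j]. *)
Lemma meeting_block k j p t : t \in meetings k p -> ~~ (2 ^ j %| t) ->
  p %/ 2 ^ j = t %/ 2 ^ j.
Proof.
case/mapP => i _ -> {t}.
have [leji|ltij _] := leqP j i.
  by rewrite dvdn_add ?dvdn_mull ?dvdn_exp2l // ltnW.
rewrite -(subnK ltij) addnC expnD !divnMA divnMDl ?expn_gt0 //.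
by rewrite (@divn_small (2 ^ i)) ?addn0 // ltn_exp2l.
Qed.

Lemma block_meeting k j p b : j < k -> p %/ 2 ^ j.+1 = b ->
  active k p (b.*2.+1 * 2 ^ j).
Proof.
move=> ltjk <-; rewrite /active !inE; apply/orP; right; apply/orP; right.
apply/mapP; exists j; first by rewrite mem_iota.
by rewrite mulSnr expnS -muln2 -mulnA.
Qed.

Lemma sum_mem_le (s : seq nat) T : \sum_(t < T) (val t \in s) <= size s.
Proof.
rewrite -(big_mkord xpredT (fun t => (t \in s) : nat)).
rewrite -sum1_size -big_mkcond /= -big_filter.
rewrite sum1_size sum1_size; apply: uniq_leq_size => [|x].
  by rewrite filter_uniq ?iota_uniq.
by rewrite mem_filter => /andP[].
Qed.

(** * Local rules of the protocol *)

Section Protocol.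

Variables (n : nat) (V : Type) (k f : nat).
Implicit Types (p q r : 'I_n) (t : nat) (u v : V) (ib : 'I_n -> option V).

Definition received p v ib q : option V := if q == p then Some v else ib q.

(** [V] being arbitrary, the value is chosen through a processor it comes from, and occurrences are
    counted with classical equality. *)
Definition frequent p v ib : option V :=
  obind (received p v ib)
    [pick q | received p v ib q
            & f < #|[set r | `[< received p v ib r = received p v ib q >]]|].

(** The round number is the pivot: IDs below [t] are on the sending side. This also covers the final
    broadcast, whose senders are the IDs below [2 ^ k]. *)
Definition update p t v ib : V :=
  if t == 0 then odflt v (frequent p v ib)
  else if p < t then v
  else odflt v (obind ib [pick q | ib q : bool]).

(* The state is the number of the round in which the processor is next awake,
   and its current value. *)
Definition tree_compute p (s : nat * V) ib : action V (nat * V) :=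
  let: (t, v) := s in
  if 2 ^ k <= t then Return (update p t v ib)
  else let w := find (active k p) (iota t.+1 (2 ^ k - t)) in
       Sleep w (t.+1 + w, update p t v ib).

Definition tree_send p (s : nat * V) q : option V :=
  if (s.1 == 0) || (p < s.1) then Some s.2 else None.

Definition tree_algorithm : algorithm n V :=
  @Algorithm n V (nat * V)%type V (fun _ v => (0, v)) tree_send tree_compute.

Lemma frequentP p v ib v0 : frequent p v ib = Some v0 ->
  exists q, received p v ib q = Some v0 /\
    f < #|[set r | `[< received p v ib r = Some v0 >]]|.
Proof.
rewrite /frequent; case: pickP => //= q /andP[_ lt_f] eq_q.
by exists q; split=> //; rewrite -eq_q.
Qed.

Lemma frequent_exists p v ib q v0 : received p v ib q = Some v0 ->
    f < #|[set r | `[< received p v ib r = Some v0 >]]| ->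
  exists v1, frequent p v ib = Some v1.
Proof.
move=> rq lt_f; rewrite /frequent; case: pickP => [r /andP[]|/(_ q)] /=.
  by case: received => // v1; exists v1.
by rewrite rq lt_f.
Qed.

Lemma update_origin p t v ib v' : update p t v ib = v' ->
  v' = v \/ exists q, ib q = Some v' /\ ((t == 0) || (t <= p)).
Proof.
rewrite /update; case: eqP => [_|_].
  case E: (frequent p v ib) => [v1|] /= <-; last by left.
  have [q [+ _]] := frequentP E; rewrite /received; case: eqP => _.
    by case=> <-; left.
  by right; exists q.
case: ltnP => [_|le_tp]; first by left.
case: pickP => [q|] /=; last by left.
by case E: (ib q) => [v1|] //= _ <-; right; exists q.
Qed.

Lemma update_received p t v ib v' q : 0 < t -> t <= p -> ib q ->
  update p t v ib = v' -> exists r, ib r = Some v'.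
Proof.
rewrite /update lt0n => /negbTE -> le_tp; rewrite ltnNge le_tp /=.
case: pickP => [r|/(_ q) -> //] /=.
by case E: (ib r) => [v1|] //= _ _ <-; exists r.
Qed.

(** * Executions and the sleeping schedule *)

Variables (input : 'I_n -> V) (adv : adversary n).

Notation conf := (exec tree_algorithm input adv).
Notation mail t := (@inbox n V tree_algorithm adv t (conf t)).

(** Only crashed processors have no value, so agreement is proved for all processors still alive,
    even those that crash later. *)
Definition value (s : status V (nat * V)) : option V :=
  match s with
  | Running _ s => Some s.2
  | Returned v => Some v
  | Crashed => None
  end.

Definition holds t p v : Prop := value (conf t p) = Some v.

Lemma holds_inj t p u v : holds t p u -> holds t p v -> u = v.
Proof. by rewrite /holds => -> []. Qed.

(** This invariant is meant for rounds up to [2 ^ k], before the end of which no processor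
    returns. *)
Definition on_schedule t p (s : status V (nat * V)) : Prop :=
  match s with
  | Running w (t', _) =>
      [/\ t' = t + w, t' <= 2 ^ k, active k p t' &
          forall i, i < w -> ~~ active k p (t + i)]
  | Returned _ => False
  | Crashed => True
  end.

Lemma active_end p : active k p (2 ^ k).
Proof. by rewrite /active !inE eqxx orbT. Qed.

Lemma exec_on_schedule t p : t <= 2 ^ k -> on_schedule t p (conf t p).
Proof.
elim: t => [|t IH] lt_tk /=.
  by split=> //; rewrite /active ?inE ?eqxx.
rewrite /round; case: eqP => [//|_].
have := IH (ltnW lt_tk).
case: (conf t p) => [w [t' v]|//|//] /= [et' le_t'k at' nact].
case: w et' nact => [|w] et' nact.
  rewrite addn0 in et'; subst t'.
  rewrite /= leqNgt lt_tk /=; set l := iota _ _.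
  have hasl: has (active k p) l.
    apply/hasP; exists (2 ^ k); last exact: active_end.
    by rewrite mem_iota; lia.
  have lt_find: find (active k p) l < 2 ^ k - t.
    by rewrite -[X in _ < X](size_iota t.+1) -has_find.
  split=> //; first by lia.
    by have := nth_find 0 hasl; rewrite nth_iota.
  move=> i lt_i; have := before_find 0 lt_i.
  by rewrite nth_iota ?(ltn_trans lt_i) // => ->.
split=> //; first by lia.
by move=> i lt_iw; have := nact i.+1; rewrite addnS; apply.
Qed.

Lemma exec_stopped p t : 2 ^ k < t -> forall w s, conf t p <> Running w s.
Proof.
elim: t => // t IH; rewrite ltnS leq_eqVlt => /orP[/eqP <-|lt_kt] w s /=.
  rewrite /round; case: eqP => // _.
  have := exec_on_schedule p (leqnn (2 ^ k)).
  case: (conf _ p) => // [w' [t' v]] /= [].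
  by case: w' => [|w'] -> //; [rewrite addn0 /= leqnn | lia].
rewrite /round; case: eqP => // _.
by have := IH lt_kt; case: (conf t p) => // w' s' /(_ w' s').
Qed.

Lemma awake_active t p : awake (conf t) p -> active k p t.
Proof.
rewrite /awake; have [le_tk|lt_kt] := leqP t (2 ^ k).
  have := exec_on_schedule p le_tk; case: (conf t p) => // [[|w]] [t' v] //=.
  by rewrite addn0 => -[-> _].
by have := exec_stopped (p := p) lt_kt; case: (conf t p) => // w s /(_ w s).
Qed.

(** * Propagation of values *)

Lemma holds_active t p v : t <= 2 ^ k -> active k p t -> holds t p v ->
  conf t p = Running 0 (t, v).
Proof.
move=> le_tk at_; have := exec_on_schedule p le_tk.
rewrite /holds; case: (conf t p) => // [[|w]] [t' v'] /= [-> _ _ nact] [->].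
  by rewrite addn0.
by have := nact 0 isT; rewrite addn0 at_.
Qed.

Lemma holds_step t p v : t <= 2 ^ k -> holds t.+1 p v ->
  exists u, [/\ holds t p u, crash_round adv p <> Some t &
    v = if active k p t then update p t u (mail t p) else u].
Proof.
move=> le_tk; rewrite /holds /= /round; case: eqP => // ncr.
have [at_|nat_] := boolP (active k p t); last first.
  have := exec_on_schedule p le_tk.
  case E: (conf t p) => [w [t' v']|//|//] /= [et' _ at' _].
  case: w et' E => [|w] et' E /=.
    by rewrite et' addn0 (negbTE nat_) in at'.
  case=> ev.
  by exists v'.
case E: (value (conf t p)) => [u|]; last by case: (conf t p) E => //= -[|w] s.
rewrite (holds_active le_tk at_ E) /=.
by case: leqP => _ /= e; exists u; split=> //; case: e.
Qed.

Lemma mail_origin t p q v : t <= 2 ^ k -> mail t p q = Some v ->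
  [/\ active k q t, (t == 0) || (q < t) & holds t q v].
Proof.
move=> le_tk; rewrite /inbox; case: ifP => // _; rewrite /sent.
have := @awake_active t q; have := exec_on_schedule q le_tk.
rewrite /awake /holds; case: (conf t q) => // -[|w] [t' v'] //=.
rewrite addn0 => -[-> _ _ _] /(_ isT) aqt; case: eqP => // _.
by rewrite /tree_send /=; case: orP => // /orP h [<-].
Qed.

Lemma mail_arrives t p q v : t <= 2 ^ k -> crash_round adv q <> Some t ->
    q != p -> active k q t -> (t == 0) || (q < t) -> holds t q v ->
  mail t p q = Some v.
Proof.
move=> le_tk /eqP ncr neq aqt ok hq; rewrite /inbox (negbTE ncr) /= /sent.
by rewrite (holds_active le_tk aqt hq) (negbTE neq) /= /tree_send /= ok.
Qed.

Lemma holds_origin t p v : 0 < t -> t <= 2 ^ k -> holds t.+1 p v ->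
  holds t p v \/
  exists q, [/\ t <= p, q < t, active k p t, active k q t & holds t q v].
Proof.
move=> t_gt0 le_tk /(holds_step le_tk)[u [hu _]].
case: ifP => [apt|_] /esym ev; last by left; rewrite -ev.
have [->|[q [mq]]] := update_origin ev; first by left.
rewrite eqn0Ngt t_gt0 /= => le_tp; right; exists q.
by have [] := mail_origin le_tk mq; rewrite eqn0Ngt t_gt0.
Qed.

(** A positive round changes only the values of IDs at least its own number, so [p] is past its last
    change. *)
Lemma holds_late t t' p v : p < t -> t <= t' -> t' <= (2 ^ k).+1 ->
  holds t' p v -> holds t p v.
Proof.
move=> lt_pt /subnK <-; elim: (t' - t) => // d IH; rewrite addSn => le_k h.
apply: IH; first lia.
have [||//|[q [le_p _ _ _ _]]] := holds_origin _ _ h; lia.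
Qed.

(** A sender still alive after round [t] did not crash in it, so its message reached [p]. The value
    adopted may still come from another sender [r]. *)
Lemma holds_delivered t p q u v : 0 < t -> t <= 2 ^ k -> q < t -> t <= p ->
    active k p t -> active k q t -> holds t.+1 q u -> holds t.+1 p v ->
  exists r, [/\ r < t, active k r t & holds t r v].
Proof.
move=> t_gt0 le_tk lt_qt le_tp apt aqt.
case/(holds_step le_tk)=> u' [hq ncr _] /(holds_step le_tk)[v' [_ _]].
rewrite apt => /esym ev.
have neq_qp: q != p by rewrite -val_eqE /= neq_ltn (leq_trans lt_qt).
have mq := mail_arrives (p := p) le_tk ncr neq_qp aqt.
rewrite lt_qt orbT in mq; have {}mq := mq _ isT hq.
have [|r mr] := update_received t_gt0 le_tp _ ev (q := q); first by rewrite mq.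
exists r; have [] := mail_origin le_tk mr.
by rewrite eqn0Ngt t_gt0.
Qed.

(** * Agreement inside the blocks *)

(** This isolates the recursive call on a block: a round strictly inside it is no multiple of
    [2 ^ j], and is neither 0 nor [2 ^ k]. *)
Lemma meeting_in_block t q j b : b * 2 ^ j < t < b.+1 * 2 ^ j -> t < 2 ^ k ->
  active k q t -> q %/ 2 ^ j = b.
Proof.
move=> /andP[lo hi] lt_tk; have gt0: 0 < 2 ^ j by rewrite expn_gt0.
have tb: t %/ 2 ^ j = b.
  by apply/eqP; rewrite eqn_leq -ltnS ltn_divLR // hi leq_divRL // ltnW.
rewrite /active !inE => /or3P[/eqP|/eqP|mt]; [lia|lia|].
rewrite (meeting_block mt) //; apply/negP => dv.
by move: lo; rewrite -[t](divnK dv) tb ltnn.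
Qed.

(** The start is just after the boundary round [b * 2 ^ j], in which outside messages may arrive;
    later messages come from the block itself. *)
Lemma block_validity j b v t : b.+1 * 2 ^ j <= 2 ^ k ->
    (forall p u, p %/ 2 ^ j = b -> holds (b * 2 ^ j).+1 p u -> u = v) ->
    b * 2 ^ j < t <= b.+1 * 2 ^ j ->
  forall p u, p %/ 2 ^ j = b -> holds t p u -> u = v.
Proof.
move=> le_k start; elim: t => // t IH /andP[]; rewrite ltnS leq_eqVlt.
move=> /orP[/eqP <- _|lo hi]; first exact: start.
move=> p u pb h; have IH' := IH _ _ _ _.
have [||hp|[q [_ _ _ aq hq]]] := holds_origin _ _ h; [lia|lia| |].
  by apply: (IH _ p) => //; lia.
by apply: (IH _ q) => //; [lia | apply: meeting_in_block aq; lia].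
Qed.

(** The induction on [j] assumes nothing on the starting values, so it applies to the second half
    whatever happened at the meeting. *)
Lemma block_agreement j b : j <= k -> b.+1 * 2 ^ j <= 2 ^ k ->
  forall p q u v, p %/ 2 ^ j = b -> q %/ 2 ^ j = b ->
  holds (b.+1 * 2 ^ j) p u -> holds (b.+1 * 2 ^ j) q v -> u = v.
Proof.
elim: j b => [|j IH] b lejk le_k p q u v.
  rewrite !divn1 => pb qb; have -> : p = q by apply: val_inj; rewrite /= pb.
  exact: holds_inj.
have gt0: 0 < 2 ^ j by rewrite expn_gt0.
have e2 : b.+1 * 2 ^ j.+1 = b.*2.+2 * 2 ^ j by rewrite expnS; lia.
set t := b.*2.+1 * 2 ^ j.
have et : b.+1 * 2 ^ j.+1 = t + 2 ^ j by rewrite e2 /t; lia.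
have et' : b * 2 ^ j.+1 + 2 ^ j = t by rewrite /t expnS; lia.
have half r : r %/ 2 ^ j.+1 = b ->
    r %/ 2 ^ j = (if r < t then b.*2 else b.*2.+1) /\ active k r t.
  move=> rb; split; last exact: block_meeting.
  have := leq_divM r (2 ^ j.+1); have := ltn_ceil r (expn_gt0 2 j.+1).
  rewrite rb et -et' => hi lo; rewrite et'; apply/eqP; case: ltnP => h.
    rewrite eqn_leq -ltnS ltn_divLR // leq_divRL //.
    by rewrite -/t h /=; move: lo; rewrite expnS; lia.
  rewrite eqn_leq -ltnS ltn_divLR // leq_divRL // h andbT.
  by move: hi; rewrite et'; rewrite /t; lia.
have le_t: t <= 2 ^ k by lia.
have t_gt0: 0 < t by rewrite /t; lia.
have meeters r : active k r t -> r %/ 2 ^ j.+1 = b.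
  by move=> ar; apply: (meeting_in_block (t := t)) ar; lia.
(* The rounds of block [b.*2] end where the meeting round [t] begins. *)
have left_agree p' q' u' v' : p' < t -> q' < t -> active k p' t ->
    active k q' t -> holds t p' u' -> holds t q' v' -> u' = v'.
  move=> lp lq ap aq; apply: (IH b.*2) => //; first by lia.
    by have [] := half _ (meeters _ ap); rewrite lp.
  by have [] := half _ (meeters _ aq); rewrite lq.
(* A survivor of the first half was alive after round [t], so the second half adopted the agreed
   value, which [block_validity] preserves. *)
have mixed p' q' u' v' : p' < t -> t <= q' -> p' %/ 2 ^ j.+1 = b ->
    q' %/ 2 ^ j.+1 = b -> holds (b.+1 * 2 ^ j.+1) p' u' ->
    holds (b.+1 * 2 ^ j.+1) q' v' -> v' = u'.
  move=> lp lq pb qb hp hq.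
  have hp1 : holds t.+1 p' u' by apply: holds_late hp; lia.
  have hpt : holds t p' u' by apply: holds_late hp1; lia.
  have [_ ap] := half _ pb; have [qh _] := half _ qb.
  rewrite ltnNge lq /= in qh.
  apply: (@block_validity j b.*2.+1 u' (b.*2.+2 * 2 ^ j)) qh _; last 1 first.
  - by rewrite -e2.
  - by rewrite -e2.
  - move=> r w rb; rewrite -/t => hr.
    have le_tr : t <= r by rewrite /t -rb leq_divM.
    have rb' : r %/ 2 ^ j.+1 = b by rewrite expnSr divnMA rb; lia.
    have [_ ar] := half _ rb'.
    have [s [ls as_ hs]] := holds_delivered t_gt0 le_t lp le_tr ar ap hp1 hr.
    exact: left_agree hs hpt.
  - by lia.
move=> pb qb hp hq; have [ph ap] := half _ pb; have [qh aq] := half _ qb.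
have [lp|lp] := ltnP p t; have [lq|lq] := ltnP q t.
- by apply: (left_agree p q) => //;
    [apply: holds_late hp | apply: holds_late hq]; lia.
- by apply/esym; apply: mixed hp hq.
- by apply: mixed hq hp.
- rewrite ltnNge lp /= in ph; rewrite ltnNge lq /= in qh.
  by move: hp hq; rewrite e2; apply: IH => //; lia.
Qed.

(** * Final values of all processors *)

Lemma agreed_value v t :
    (forall p u, holds 1 p u -> u = v) -> 0 < t <= (2 ^ k).+1 ->
  forall p u, holds t p u -> u = v.
Proof.
move=> start; elim: t => // t IH /andP[_]; rewrite ltnS => le_k.
case: (posnP t) => [->|t_gt0] p u h; first exact: start h.
have [hp|[q [_ _ _ _ hq]]] := holds_origin t_gt0 le_k h.
  by apply: IH hp; rewrite t_gt0 leqW.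
by apply: IH hq; rewrite t_gt0 leqW.
Qed.

Lemma nonfaulty_holds t p : nonfaulty adv p -> exists v, holds t p v.
Proof.
rewrite /nonfaulty /faulty negbK => /eqP ncr.
elim: t => [|t [v]]; first by exists (input p).
rewrite /holds /= /round ncr /=; case: (conf t p) => [[|w] s|v'|] //= h.
- by case: s {h} => t' v'; rewrite /=; case: ifP => _; eexists.
- by exists s.2.
- by exists v'.
Qed.

Lemma final_output p v : holds (2 ^ k).+1 p v ->
  outputs tree_algorithm input adv p v.
Proof.
have := exec_stopped (p := p) (ltnSn (2 ^ k)); rewrite /holds.
case E: (conf _ p) => [w s|v'|] //= stop; first by have := stop w s.
by case=> <-; exists (2 ^ k).+1.
Qed.

Lemma outputs_final p v : outputs tree_algorithm input adv p v ->
  nonfaulty adv p -> holds (2 ^ k).+1 p v.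
Proof.
rewrite /nonfaulty /faulty negbK => -[t et] /eqP ncr.
have stay d : conf (t + d) p = Returned v.
  by elim: d => [|d IH]; rewrite ?addn0 // addnS /= /round ncr IH.
have gt : 2 ^ k < t.
  rewrite ltnNge; apply/negP => /(exec_on_schedule p); by rewrite et.
have stay' m d : 2 ^ k < m -> conf (m + d) p = conf m p.
  move=> lt_m; elim: d => [|d IH]; rewrite ?addn0 // addnS /= /round ncr /= IH.
  by have := exec_stopped (p := p) lt_m; case: (conf m p) => // w s /(_ w s).
by rewrite /holds -(stay' _ (t - (2 ^ k).+1)) // subnKC // et.
Qed.

Lemma crash_neq t p : nonfaulty adv p -> crash_round adv p <> Some t.
Proof. by rewrite /nonfaulty /faulty negbK => /eqP ->. Qed.

Hypothesis few : crashes_at_most adv f.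

(** At most [f] of the [f.+1] smallest IDs are faulty. *)
Lemma nonfaulty_leader : f < n -> f < 2 ^ k ->
  exists2 p, nonfaulty adv p & p < 2 ^ k.
Proof.
move=> lt_fn lt_fk.
have : ~~ ([set widen_ord lt_fn i | i in 'I_f.+1]
             \subset [set p | faulty adv p]).
  apply/negP => /subset_leq_card; rewrite card_imset ?card_ord => [|i i'].
    by rewrite leqNgt ltnS few.
  by move/(congr1 val) => /= h; apply: val_inj.
case/subsetPn => p /imsetP[i _ ->]; rewrite inE => nf.
exists (widen_ord lt_fn i) => //=; exact: leq_trans (ltn_ord i) lt_fk.
Qed.

(** The IDs below [2 ^ k] form one block, hence agree; a non-faulty one among them survives the
    broadcast, so the other processors alive adopt this value. *)
Lemma final_agreement p q u v : f < n -> f < 2 ^ k ->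
  holds (2 ^ k).+1 p u -> holds (2 ^ k).+1 q v -> u = v.
Proof.
move=> lt_fn lt_fk hp hq.
have gt0: 0 < 2 ^ k by rewrite expn_gt0.
have [l nl lt_lk] := nonfaulty_leader lt_fn lt_fk.
have [w hl] := nonfaulty_holds (2 ^ k) nl.
have [w' hl'] := nonfaulty_holds (2 ^ k).+1 nl.
have common r x : r < 2 ^ k -> holds (2 ^ k) r x -> x = w.
  move=> lt_r hr.
  apply: (@block_agreement k 0 _ _ r l) => //; rewrite ?mul1n //.
    by rewrite divn_small.
  by rewrite divn_small.
suff all r x : holds (2 ^ k).+1 r x -> x = w.
  by rewrite (all _ _ hp) (all _ _ hq).
move=> hr; have [lt_r|le_r] := ltnP r (2 ^ k).
  by apply: (common r x lt_r); apply: holds_late hr.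
have [s [ls _ hs]] :=
  holds_delivered gt0 (leqnn _) lt_lk le_r (active_end r) (active_end l) hl' hr.
exact: common ls hs.
Qed.

(** * Effect of the preliminary round *)

(** More than [f] processors are non-faulty, so a frequent value exists; having a non-faulty source,
    it can only be [v]. *)
Lemma majority_start v : f.*2 < n ->
    (forall p, nonfaulty adv p -> input p = v) ->
  forall p u, holds 1 p u -> u = v.
Proof.
move=> lt_fn in_v p u /(@holds_step 0)[//|w [hw _]].
have a0 r : active k r 0 by rewrite /active inE eqxx.
rewrite a0 /update eqxx.
have get r : nonfaulty adv r -> received p w (mail 0 p) r = Some v.
  move=> nr; rewrite /received; case: eqP => [er|/eqP neq].
    by move: hw; rewrite -er /holds /= in_v.
  apply: mail_arrives => //; first exact: crash_neq.
  by rewrite /holds /= in_v.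
have many : f < #|[set r | nonfaulty adv r]|.
  have := cardsC [set r | faulty adv r]; rewrite card_ord.
  have -> : ~: [set r | faulty adv r] = [set r | nonfaulty adv r].
    by apply/setP => r; rewrite !inE.
  move: few; rewrite /crashes_at_most; lia.
have [r nr] : exists r, r \in [set r | nonfaulty adv r].
  by apply/card_gt0P; apply: leq_trans many.
rewrite inE in nr.
have [|v1 ev1] := frequent_exists (get r nr).
  apply: leq_trans many _; apply: subset_leq_card; apply/subsetP => r'.
  by rewrite !inE => nr'; apply/asboolP; apply: get.
rewrite ev1 /= => ->.
have [_ [_ lt_f]] := frequentP ev1.
have : ~~ ([set r | `[< received p w (mail 0 p) r = Some v1 >]]
             \subset [set p | faulty adv p]).
  by apply/negP => /subset_leq_card; rewrite leqNgt (leq_ltn_trans few).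
case/subsetPn => r'; rewrite !inE => /asboolP er' nr'.
by move: er'; rewrite get // => -[].
Qed.

Lemma common_start v : (forall p, input p = v) ->
  forall p u, holds 1 p u -> u = v.
Proof.
move=> in_v p u; case/(@holds_step 0)=> // w [hw _].
have h0 r x : holds 0 r x -> x = v by rewrite /holds /= in_v => -[].
case: (active k p 0) => /esym; last by move <-; apply: h0 hw.
case/update_origin=> [->|[q [mq _]]]; first exact: h0 hw.
by have [|_ _ hq] := mail_origin _ mq; last exact: h0 hq.
Qed.

End Protocol.

(** * Correctness and complexity *)

Lemma tree_solves n V k f : f < n -> f < 2 ^ k ->
  solves_crash_agreement (tree_algorithm n V k f) f.
Proof.
move=> lt_fn lt_fk input adv few.
have valid v p : (forall p u, @holds n V k f input adv 1 p u -> u = v) ->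
    nonfaulty adv p -> outputs (tree_algorithm n V k f) input adv p v.
  move=> start np; have [u hu] := nonfaulty_holds k f input (2 ^ k).+1 np.
  have <- : u = v by apply: agreed_value start _ _ _ hu; rewrite ltnSn.
  exact: final_output.
split.
- move=> p v np op q nq; have hp := outputs_final op np.
  have [u hu] := nonfaulty_holds k f input (2 ^ k).+1 nq.
  by rewrite (final_agreement few lt_fn lt_fk hp hu); apply: final_output.
- by move=> v in_v p; apply: valid; apply: common_start.
- by move=> lt2 v in_v p; apply: valid; apply: majority_start.
- move=> p np; have [u hu] := nonfaulty_holds k f input (2 ^ k).+1 np.
  by exists u; apply: final_output.
Qed.

Lemma tree_awake n V k f :
  awake_complexity_le (tree_algorithm n V k f) f k.+2.
Proof.
move=> input adv _ p T.
have := sum_mem_le [:: 0, 2 ^ k & meetings k p] T.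
rewrite /= size_map size_iota; apply: leq_trans.
apply: leq_sum => t _; case E: (awake _ _) => //.
by have := awake_active E; rewrite /active => ->.
Qed.

(* [maxn 1] only matters for f = 0 (both bounds) and f = 1 (logarithm). *)
Theorem mainTheorem1 :
  exists C : nat, forall (n f : nat) (V : Type), f < n ->
  exists A : algorithm n V,
    [/\ solves_crash_agreement A f,
        awake_complexity_le A f (C * maxn 1 (trunc_log 2 f)) &
        round_complexity_le A f (C * maxn 1 f)].
Proof.
(* The awake bound is [k.+2 = trunc_log 2 f + 3], which is 4 when the logarithm is 1; the round
   bound [(2 ^ k).+1] is at most [2 * maxn 1 f + 1]. *)
exists 4 => n f V lt_fn.
pose k := (trunc_log 2 f).+1; exists (tree_algorithm n V k f).
split.
- by apply: tree_solves => //; apply: trunc_log_ltn.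
- move=> input adv few p T; have := @tree_awake n V k f input adv few p T.
  by rewrite /k; lia.
- have le_k : 2 ^ k <= 2 * maxn 1 f.
    rewrite expnS leq_mul2l; case: f lt_fn @k => [|f] lt_fn //.
    by have := trunc_logP (isT : 1 < 2) (isT : 0 < f.+1); lia.
  by move=> input adv few p; apply: exec_stopped; lia.
Qed.
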